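(* Let $(\Omega,\mathcal F,\mathbb P)$ be an atomless probability space, let $p\in(0,1)$ and let $\rho:L^\infty\to\mathbb R$ be a risk measure. Then $\rho$ satisfies [M], [TI], [$p$-CA] and $\rho(0)=0$ if and only if it has the form $$\rho(X)=g(\mathrm{ES}_p(X)-\mathbb E[X])+\mathbb E[X],\qquad X\in L^\infty,$$ for some increasing function $g:[0,\infty)\to\mathbb R$ with $g(0)=0$ satisfying the $1$-Lipschitz condition $|g(x)-g(y)|\le|x-y|$ for all $x,y\ge0$. In particular, any such $\rho$ is a consistent risk measure.
   Context: $(\Omega,\mathcal F,\mathbb P)$ is atomless; $L^\infty$ is the space of essentially bounded random variables. A risk measure is simply a functional on this space. ''Increasing'' means non-strictly increasing. $X\overset{d}{=}Y$ means equality in law. For $p\in(0,1)$, $\mathrm{VaR}_p(X)=\inf\{x\in\mathbb R:\mathbb P(X\le x)\ge p\}$ and $\mathrm{ES}_p(X)=\frac1{1-p}\int_p^1\mathrm{VaR}_s(X)\,ds$. A tail event of a random variable $X$ is an event $A\in\mathcal F$ with $0<\mathbb P(A)<1$ such that $X(\omega)\ge X(\omega')$ for a.s. all $\omega\in A$ and $\omega'\in A^c$. A $p$-tail event of $X$ is a tail event of $X$ with probability $1-p$. A random vector is $p$-concentrated if its components share a common $p$-tail event. [M]: $\rho(X)\le\rho(Y)$ whenever $X\le Y$ pointwise. [TI]: $\rho(X+c)=\rho(X)+c$ for all $X$ and all $c\in\mathbb R$. [$p$-CA]: $\rho(X+Y)\le\rho(X'+Y')$ for all $X,Y,X',Y'\in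 L^\infty$ such that $(X',Y')$ is $p$-concentrated, $X\overset{d}{=}X'$ and $Y\overset{d}{=}Y'$. A monetary risk measure is one satisfying [M] and [TI]. A consistent risk measure is a monetary risk measure satisfying SSD-consistency: $\rho(X)\le\rho(Y)$ whenever $\mathbb E[u(X)]\le\mathbb E[u(Y)]$ for all increasing convex functions $u:\mathbb R\to\mathbb R$. *)

(* Defs.v *)
(* MathComp-Analysis. *)
From HB Require Import structures.
From mathcomp Require Import all_boot all_order all_algebra.
From mathcomp Require Import all_classical all_reals all_analysis.
From mathcomp Require Import ess_sup_inf.

Set Implicit Arguments.
Unset Strict Implicit.
Unset Printing Implicit Defensive.

Import Order.TTheory GRing.Theory Num.Theory.
Import numFieldNormedType.Exports.

Local Open Scope classical_set_scope.
Local Open Scope ring_scope.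

Definition atomless (d : measure_display) (T : measurableType d) (R : realType)
    (P : probability T R) : Prop :=
  forall A : set T, measurable A -> (0 < P A)%E ->
    exists B : set T, [/\ measurable B, B `<=` A & (0 < P B < P A)%E].

(* Elements are functions, not classes modulo almost sure equality, so that
   pointwise comparison makes sense; two almost surely equal elements may
   a priori have different images under a functional on [Linfty P]. *)
Notation Linfty P := (LfunType P (leey 1%E)).

Section RiskMeasures.
Context (d : measure_display) (T : measurableType d) (R : realType).
Variable P : probability T R.
Implicit Types (p c : R) (X Y : Linfty P) (A : set T) (rho : Linfty P -> R).

Lemma Lfun_infty_cst c : cst c \in Lfun P +oo%E.
Proof.
rewrite inE; apply/andP; split; rewrite inE//=.
rewrite /finite_norm unlock /= probability_setT lte01.
apply: (@le_lt_trans _ _ `|c|%:E); last exact: ltry.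
by apply/ess_supP/nearW => w /=.
Qed.

Definition Linfty_cst c : Linfty P := Lfun_Sub _ (Lfun_infty_cst c).

Definition mean X : R := fine 'E_P[X].

Definition VaR (s : R) X : R :=
  inf [set x : R | (s%:E <= P [set w | (X w <= x)%R])%E].

(* At the end point s = 1, which is Lebesgue-negligible, [VaR] is the
   essential supremum. *)
Definition ES p X : R :=
  (1 - p)^-1 * \int[lebesgue_measure]_(s in `[p, 1]) VaR s X.

Definition eq_law X Y : Prop :=
  forall B : set R, measurable B -> distribution P X B = distribution P Y B.

Definition tail_event X A : Prop :=
  [/\ measurable A, (0 < P A < 1)%E &
      {ae P, forall w, A w -> {ae P, forall w', ~ A w' -> X w' <= X w}}].

Definition p_tail_event p X A : Prop := tail_event X A /\ P A = (1 - p)%:E.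

Definition p_concentrated p (n : nat) (X : n.-tuple (Linfty P)) : Prop :=
  exists A, forall i : 'I_n, p_tail_event p (tnth X i) A.

Definition risk_monotone rho : Prop :=
  forall X Y, (forall w, X w <= Y w) -> rho X <= rho Y.

Definition risk_translation_invariant rho : Prop :=
  forall X c, rho (X + Linfty_cst c) = rho X + c.

Definition risk_concentration_averse p rho : Prop :=
  forall X Y X' Y', p_concentrated p [tuple X'; Y'] ->
    eq_law X X' -> eq_law Y Y' -> rho (X + Y) <= rho (X' + Y').

Definition risk_monetary rho : Prop :=
  risk_monotone rho /\ risk_translation_invariant rho.

(* The expectations below are finite: a convex function on the real line is
   bounded on bounded sets. *)
Definition risk_SSD_consistent rho : Prop :=
  forall X Y,
    (forall u : R -> R, {homo u : x y / x <= y} ->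
       convex_function [set: R^o] u ->
       ('E_P[u \o X] <= 'E_P[u \o Y])%E) ->
    rho X <= rho Y.

Definition risk_consistent rho : Prop :=
  risk_monetary rho /\ risk_SSD_consistent rho.

End RiskMeasures.

(* Main.v *)
(* The analytic core is that, for every p-tail event A of X, one has
   (1 - p) ES_p(X) = E[X 1_A]; in particular ES_p is subadditive, and additive
   on p-concentrated pairs, and so every mean-ES functional satisfies the
   axioms.

   Conversely, p-concentration aversion applied to two concentrated pairs with
   the same marginals gives equality.  Let X be a step function on an equal
   partition of A and on one of its complement, with X >= t on A and X <= t
   off A.  Slicing X - t into n equal parts and shifting the s-th part
   cyclically by s inside each block does not change rho and averages X over A
   and over its complement.  Squeezing a general X between two such step
   functions whose block means are close shows that rho(X) only depends on
   ES_p(X) and E[X]; translation invariance then yields g.  That g is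
   1-Lipschitz from above is monotonicity of rho, and g increases because
   Z + l 1_C - l 1_D, a sum of concentrated summands, can be rearranged
   into Z. *)
From HB Require Import structures.
Require Import Defs.
From mathcomp Require Import all_boot all_order all_algebra.
From mathcomp Require Import all_classical all_reals all_analysis.
From mathcomp Require Import ess_sup_inf measurable_realfun lra ring.
Import Order.TTheory GRing.Theory Num.Theory.
Import numFieldNormedType.Exports.
Local Open Scope ring_scope.
Local Open Scope classical_set_scope.
Set Implicit Arguments.
Unset Strict Implicit.
Unset Printing Implicit Defensive.

(** * Atomless probability spaces *)

Section RealProbability.
Context (d : measure_display) (T : measurableType d) (R : realType).
Variable P : probability T R.
Implicit Types (A B C D E : set T).

Definition prob A : R := fine (P A).

Lemma probE A : measurable A -> P A = (prob A)%:E.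
Proof. by move=> mA; rewrite fineK// fin_num_measure. Qed.

Lemma prob_ge0 A : 0 <= prob A.
Proof. exact/fine_ge0/measure_ge0. Qed.

Lemma prob_le1 A : measurable A -> prob A <= 1.
Proof. by move=> mA; rewrite -lee_fin -probE// probability_le1. Qed.

Lemma prob0 : prob set0 = 0.
Proof. by rewrite /prob measure0. Qed.

Lemma probT : prob setT = 1.
Proof. by rewrite /prob probability_setT. Qed.

Lemma prob_le A B : measurable A -> measurable B -> A `<=` B ->
  prob A <= prob B.
Proof.
by move=> mA mB AB; rewrite -lee_fin -!probE// le_measure// inE.
Qed.

Lemma bounds_le (f : T -> R) m M : (forall w, m <= f w <= M) -> m <= M.
Proof.
move=> fb; have [w _] : [set: T] !=set0.
  apply/set0P/eqP => T0; have := probT; rewrite T0 prob0 => /eqP.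
  by rewrite eq_sym oner_eq0.
by have /andP[mf fM] := fb w; exact: (@le_trans _ _ (f w)).
Qed.

Lemma probU A B : measurable A -> measurable B -> A `&` B = set0 ->
  prob (A `|` B) = prob A + prob B.
Proof.
move=> mA mB AB; apply: EFin_inj; rewrite EFinD -!probE//;
  last exact: measurableU.
by rewrite measureU.
Qed.

Lemma probD A B : measurable A -> measurable B -> B `<=` A ->
  prob (A `\` B) = prob A - prob B.
Proof.
move=> mA mB BA; have := @probU (A `\` B) B (measurableD mA mB) mB.
rewrite setDE -setIA setICl setI0 => /(_ erefl).
by rewrite -setDE setUC setDUK// => ->; rewrite addrK.
Qed.

Lemma probC A : measurable A -> prob (~` A) = 1 - prob A.
Proof. by move=> mA; rewrite -setTD probD// probT. Qed.

Lemma probIC A B : measurable A -> measurable B ->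
  prob A = prob (A `&` B) + prob (A `&` ~` B).
Proof.
move=> mA mB; rewrite -probU; first by rewrite -setIUr setUv setIT.
- exact: measurableI.
- exact/measurableI/measurableC.
- by rewrite setIACA setICr setI0.
Qed.

Lemma ae_prob_le A B : measurable A -> measurable B ->
  {ae P, forall w, A w -> B w} -> prob A <= prob B.
Proof.
move=> mA mB AB; have mAB : measurable (A `\` B) by exact: measurableD.
have AB0 : prob (A `\` B) = 0.
  rewrite /prob (measure_negligible mAB)//; apply: negligibleS AB.
  by move=> w [Aw nB] /(_ Aw).
rewrite -[leRHS]add0r -AB0 -probU//; last by rewrite setDE -setIA setICl setI0.
by apply: prob_le => //; [exact: measurableU|move=> w Aw; have [Bw|nB] :=
  pselect (B w); [right|left]].
Qed.

Lemma prob0_ae A : measurable A -> prob A = 0 -> {ae P, forall w, ~ A w}.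
Proof.
move=> mA A0; exists A; split => //; first by rewrite probE// A0.
by move=> w /= /contrapT.
Qed.

Lemma prob_nondecreasing_cvg (F : (set T)^nat) :
  (forall n, measurable (F n)) -> nondecreasing_seq F ->
  prob (F n) @[n --> \oo] --> prob (\bigcup_n F n).
Proof.
move=> mF ndF; apply: fine_cvg; rewrite -probE; last exact: bigcup_measurable.
exact: (@nondecreasing_cvg_mu _ _ _ P F mF (bigcup_measurable (fun i _ =>
  mF i)) ndF).
Qed.

Lemma prob_nonincreasing_cvg (F : (set T)^nat) :
  (forall n, measurable (F n)) -> nonincreasing_seq F ->
  prob (F n) @[n --> \oo] --> prob (\bigcap_n F n).
Proof.
move=> mF niF; apply: fine_cvg; rewrite -probE; last exact: bigcap_measurable.
apply: (@nonincreasing_cvg_mu _ _ _ P F) => //; last exact: bigcap_measurable.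
by rewrite [X in (X < _)%E]probE ?ltry.
Qed.

End RealProbability.

(** * Subsets of prescribed probability: Sierpinski's theorem *)

Section Sierpinski.
Context (d : measure_display) (T : measurableType d) (R : realType).
Variable P : probability T R.
Hypothesis atomlessP : atomless P.
Implicit Types (A B C D E : set T) (t : R).
Local Notation prob := (prob P).

(** Of the set given by atomlessness and its complement in [A], the lighter one has at most half the
    mass. *)
Lemma atomless_split A : measurable A -> 0 < prob A ->
  exists B, [/\ measurable B, B `<=` A, 0 < prob B & prob B *+ 2 <= prob A].
Proof.
move=> mA A0; have [|B [mB BA /andP[B0 BltA]]] := atomlessP mA.
  by rewrite probE// lte_fin.
move: B0 BltA; rewrite !probE// !lte_fin => B0 BltA.
have [h|h] := leP (prob B *+ 2) (prob A); first by exists B.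
exists (A `\` B); rewrite probD//; split;
  [exact: measurableD|exact: subDsetl|lra|lra].
Qed.

(** Halving [n] times leaves a positive mass of at most [prob A] over [2 ^ n]. Any [n] above [t^-1]
    is enough, because [2 ^ n] exceeds [n]. *)
Lemma atomless_small A t : measurable A -> 0 < prob A -> 0 < t ->
  exists B, [/\ measurable B, B `<=` A & 0 < prob B <= t].
Proof.
move=> mA A0 t0.
have H n : exists B, [/\ measurable B, B `<=` A,
  0 < prob B & prob B *+ 2 ^ n <= prob A].
  elim: n => [|n [B [mB BA B0 hB]]]; first by exists A; split;
    rewrite ?expn0 ?mulr1n.
  have [C [mC CB C0 hC]] := atomless_split mB B0.
  exists C; split => //; first exact: subset_trans BA.
  by rewrite expnS mulrnA (le_trans _ hB)// lerMn2r hC orbT.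
have [B [mB BA B0 hB]] := H (Num.bound (t^-1)).
exists B; split => //; rewrite B0/=.
have ti0 : 0 < t^-1 by rewrite invr_gt0.
have h1 := archi_boundP (ltW ti0).
rewrite leNgt; apply/negP => tB.
have : prob B *+ 2 ^ (Num.bound t^-1) <= 1 by apply: le_trans hB _;
  exact: prob_le1.
apply/negP; rewrite -ltNge -mulr_natr.
have h2 : t^-1 < (2 ^ Num.bound t^-1)%:R.
  by apply: lt_trans h1 _; rewrite ltr_nat ltn_expl.
rewrite -[X in X < _](mulfV (lt0r_neq0 t0)).
by apply: ltr_pM => //; exact: ltW.
Qed.

(** Greedy exhaustion: each stage adds a set whose mass is at least half the supremum of what still
    fits in. If the union had mass below [t], some [E] of positive mass outside it would fit in at
    every stage, and increments of at least half of [prob E] would add up to more than 1. *)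
Lemma atomless_subset B t : measurable B -> 0 <= t <= prob B ->
  exists C, [/\ measurable C, C `<=` B & prob C = t].
Proof.
move=> mB /andP[t0 tB].
pose adm C D := [/\ measurable D, D `<=` B `\` C & prob C + prob D <= t].
(* The hypotheses on [C] stand under the existential so that [choice] yields a total function. *)
have greedy C : exists D, measurable C /\ prob C <= t ->
    adm C D /\ forall E, adm C E -> prob E <= prob D *+ 2.
  have [[mC Ct]|nC] := pselect (measurable C /\ prob C <= t);
    last by exists set0.
  pose S := [set prob D | D in adm C].
  have adm0 : adm C set0 by split => //; rewrite prob0 addr0.
  have S0 : S 0 by exists set0 => //; rewrite prob0.
  have hS : has_sup S.
    split; first by exists 0.
    by exists 1 => _ [D [mD _ _] <-]; exact: prob_le1.
  have ubS E : adm C E -> prob E <= sup S.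
    by move=> aE; apply: sup_upper_bound => //; exists E.
  (* Coming within half of the supremum requires it to be positive; otherwise every admissible set
     is null and [set0] serves. *)
  have [s0|s0] := leP (sup S) 0.
    exists set0 => _; split => // E aE; rewrite prob0 mul0rn.
    exact: le_trans (ubS _ aE) s0.
  have [|_ [D aD <-] hD] := @sup_adherent _ S (sup S / 2) _ hS.
    by rewrite divr_gt0.
  exists D => _; split => // E aE; apply: le_trans (ubS _ aE) _; lra.
have [f fP] := choice greedy.
pose C := fix C n := if n is m.+1 then C m `|` f (C m) else set0.
have CP n : [/\ measurable (C n), C n `<=` B & prob (C n) <= t].
  elim: n => [|n [mC CB Ct]] /=; first by rewrite prob0; split.
  have [[mD DB Dt] _] := fP (C n) (conj mC Ct); split.
  - exact: measurableU.
  - by rewrite subUset; split => //; apply: subset_trans DB _; exact: subDsetl.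
  - by rewrite probU//; apply/seteqP; split => x // [Cx] /DB[_ /(_ Cx)].
have mC n : measurable (C n) by have [] := CP n.
have ndC : nondecreasing_seq C.
  by apply/nondecreasing_seqP => n; apply/subsetPset => x Cx; left.
pose U := \bigcup_n C n.
have mU : measurable U by exact: bigcup_measurable.
have UB : U `<=` B by apply: bigcup_sub => n _; have [] := CP n.
have cvgC := prob_nondecreasing_cvg (P := P) mC ndC.
have Ut : prob U <= t.
  apply: (cvgr_to_le cvgC).
  by apply: nearW => n; have [] := CP n.
exists U; split=> //; apply/eqP; rewrite eq_le Ut/= leNgt; apply/negP => ltUt.
(* The bound [t - prob U] on its mass keeps [E] admissible beside every [C n]. *)
have [|||E [mE EB /andP[E0 Et]]] := @atomless_small (B `\` U) (t - prob U).
- exact: measurableD.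
- by rewrite probD//; lra.
- by rewrite subr_gt0.
have step n : prob E <= (prob (C n.+1) - prob (C n)) *+ 2.
  have [_ _ Ct] := CP n.
  have [[mD DB Dt] h] := fP (C n) (conj (mC n) Ct).
  have -> : prob (C n.+1) - prob (C n) = prob (f (C n)).
    rewrite /= probU ?addrK//; first by rewrite addrC addKr.
    by apply/seteqP; split => x // [Cx] /DB[_ /(_ Cx)].
  apply: h; split => //.
  - by apply: subset_trans EB _; apply: setDS => x Cx; exists n.
  - have : prob (C n) <= prob U by apply: prob_le => // x Cx; exists n.
    lra.
have big n : prob E *+ n <= prob (C n) *+ 2.
  elim: n => [|n IH]; first by rewrite mulr0n /= prob0 mul0rn.
  rewrite mulrSr; have := step n; rewrite mulrnBl => h; lra.
have h1 : 2 / prob E < (Num.bound (2 / prob E))%:R.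
  by apply: archi_boundP; rewrite divr_ge0// ltW.
have := big (Num.bound (2 / prob E)); apply/negP; rewrite -ltNge.
apply: (@le_lt_trans _ _ 2); first by rewrite -[leRHS]/(1 *+ 2) lerMn2r
  prob_le1.
by rewrite -[X in _ < X]mulr_natl -ltr_pdivrMr.
Qed.

End Sierpinski.

(** * Upper level sets of prescribed probability *)

Section Thresholds.
Context (d : measure_display) (T : measurableType d) (R : realType).
Variable P : probability T R.
Implicit Types (A B C : set T) (f : {mfun T >-> R}) (t x m M : R).
Local Notation prob := (prob P).

Lemma measurable_mfun_gt f x : measurable [set w | x < f w].
Proof.
rewrite (_ : mkset _ = f @^-1` `]x, +oo[); last first.
  by apply/seteqP; split => w /=; rewrite in_itv/= andbT.
exact: measurable_funPTI.
Qed.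

Lemma measurable_mfun_ge f x : measurable [set w | x <= f w].
Proof.
rewrite (_ : mkset _ = f @^-1` `[x, +oo[); last first.
  by apply/seteqP; split => w /=; rewrite in_itv/= andbT.
exact: measurable_funPTI.
Qed.

Lemma measurable_mfun_le f x : measurable [set w | f w <= x].
Proof.
rewrite (_ : mkset _ = f @^-1` `]-oo, x]); last first.
  by apply/seteqP; split => w /=; rewrite in_itv/=.
exact: measurable_funPTI.
Qed.

Hypothesis atomlessP : atomless P.

(** Let [x0] be the infimum of the levels between [m] and [M] that [f] exceeds on a part of [B] of
    mass at most [t]. By continuity of the measure, the strict level set [H x0] has mass at most [t]
    and the large one [K] at least [t]. A piece of their difference, where [f] equals [x0], supplies
    the missing mass. *)
Lemma threshold_subset f B m M t : measurable B -> m <= M ->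
  (forall w, B w -> m <= f w <= M) -> 0 <= t <= prob B ->
  exists C x, [/\ measurable C /\ C `<=` B, prob C = t, m <= x <= M,
    forall w, C w -> x <= f w & forall w, B w -> ~ C w -> f w <= x].
Proof.
move=> mB mM fB /andP[t0 tB].
pose H x := B `&` [set w | x < f w].
have mH x : measurable (H x) by apply: measurableI => //;
  exact: measurable_mfun_gt.
have HB x : H x `<=` B by exact: subIsetl.
have Hni x y : x <= y -> prob (H y) <= prob (H x).
  by move=> xy; apply: prob_le => // w [Bw yw]; split => //;
    exact: le_lt_trans yw.
pose S := [set x | m <= x <= M /\ prob (H x) <= t].
have HM : prob (H M) = 0.
  rewrite (_ : H M = set0) ?prob0//; apply/seteqP; split => // w [Bw /=].
  by have /andP[_ fM] := fB _ Bw; rewrite ltNge fM.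
have SM : S M by split; rewrite ?HM// mM lexx.
have hS : has_inf S by split; [exists M|exists m => x [/andP[]]].
pose x0 := inf S.
have x0m : m <= x0 by apply: lb_le_inf; [exists M|move=> x [/andP[]]].
have x0M : x0 <= M by apply: ge_inf => //; exists m => x [/andP[]].
have Hx0 : prob (H x0) <= t.
  have eH : H x0 = \bigcup_n H (x0 + n.+1%:R^-1).
    apply/seteqP; split => [w [Bw /= xw]|w [n _ [Bw /= xw]]].
      have [k] := ltr_add_invr xw; exists k => //; split => //=.
    by split => //=; apply: lt_trans xw; rewrite ltrDl.
  have ndH : nondecreasing_seq (fun n => H (x0 + n.+1%:R^-1)).
    move=> i j ij; apply/subsetPset => w [Bw /= xw]; split => //=.
    by apply: le_lt_trans xw; rewrite lerD2l lef_pV2 ?posrE// ler_nat.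
  rewrite eH; apply: (cvgr_to_le (prob_nondecreasing_cvg (P := P) _ ndH)) => //.
  apply: nearW => n; have [|s [_ sS] sx] := inf_adherent _ hS (eps :=
    n.+1%:R^-1).
    by rewrite invr_gt0.
  by apply: le_trans sS; apply: Hni; exact: ltW.
pose K := B `&` [set w | x0 <= f w].
have mK : measurable K by apply: measurableI => //; exact: measurable_mfun_ge.
have KB : K `<=` B by exact: subIsetl.
have tK : t <= prob K.
  have eK : K = \bigcap_n H (x0 - n.+1%:R^-1).
    apply/seteqP; split => [w [Bw /= xw] n _|w xw].
      by split => //=; apply: lt_le_trans xw; rewrite gtrBl.
    have [Bw _] := xw 0%N I; split => //=.
    rewrite leNgt; apply/negP => /ltr_add_invr[k]; apply/negP; rewrite -leNgt.
    by have [_ /=] := xw k I; rewrite ltrBlDr => /ltW.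
  have niH : nonincreasing_seq (fun n => H (x0 - n.+1%:R^-1)).
    move=> i j ij; apply/subsetPset => w [Bw /= xw]; split => //=.
    by apply: le_lt_trans xw; rewrite lerD2l lerN2 lef_pV2 ?posrE// ler_nat.
  rewrite eK; apply: (cvgr_to_ge (prob_nonincreasing_cvg (P := P) _ niH)) => //.
  apply: nearW => n; set y := x0 - _.
  have yx : y < x0 by rewrite gtrBl.
  (* Levels below [m] are outside [S], but for them [H y] is all of [B]. *)
  have [ym|my] := ltP y m.
    rewrite (_ : H y = B)//; apply/seteqP; split => // w Bw; split => //=.
    by have /andP[+ _] := fB _ Bw; exact: lt_le_trans.
  rewrite leNgt; apply/negP => yt.
  suff : x0 <= y by rewrite leNgt yx.
  apply: ge_inf; first by exists m => x [/andP[]].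
  by split; [rewrite my (le_trans (ltW yx))|exact: ltW].
have HK : H x0 `<=` K by move=> w [Bw /= xw]; split => //=; exact: ltW.
have [||E [mE EK pE]] := @atomless_subset _ _ _ _ atomlessP (K `\` H x0) (t -
  prob (H x0)).
- exact: measurableD.
- by rewrite probD//; lra.
exists (H x0 `|` E), x0; split.
- split; first exact: measurableU.
  by rewrite subUset; split => // w /EK[/KB].
- rewrite probU//; first by rewrite pE; lra.
  by apply/seteqP; split => // w [Hw /EK[_ /(_ Hw)]].
- by rewrite x0m x0M.
- by move=> w [[_ /= /ltW//]|/EK[[]]].
- move=> w Bw nC; rewrite leNgt; apply/negP => xw; apply: nC; left; split => //.
Qed.

(* The pieces are listed from the top: [f] lies between [x i.+1] and [x i] on
   the [i]-th one. *)
Lemma threshold_partition f B m M N e : measurable B -> m <= M ->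
  (forall w, B w -> m <= f w <= M) -> 0 <= e -> prob B = e *+ N.+1 ->
  exists (k : T -> nat) (x : nat -> R),
    [/\ forall i, measurable (B `&` k @^-1` [set i]),
        forall i, (i <= N)%N -> prob (B `&` k @^-1` [set i]) = e,
        x 0%N = M /\ (forall i, (i <= N.+1)%N -> m <= x i <= M)
      & forall w, B w -> (k w <= N)%N /\ x (k w).+1 <= f w <= x (k w)].
Proof.
elim: N B M => [|N IH] B M mB mM fB e0 pB.
  have pre i : B `&` (fun=> 0%N) @^-1` [set i] = if i == 0%N then B else set0.
    rewrite preimage_cst/=; have [->|/eqP i0] := eqVneq i 0%N.
      by rewrite mem_set// setIT.
    by rewrite memNset ?setI0// => /esym.
  exists (fun=> 0%N), (fun i => if i is 0%N then M else m); split => //.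
  - by move=> i; rewrite pre; case: ifP.
  - by case=> // _; rewrite pre/= pB.
  - by split => // -[|i] _; rewrite mM lexx.
  - by move=> w /fB; split.
(* The top piece [C] is split off; on the rest of [B] the function is at most [y], which becomes the
   upper bound in the induction. *)
have [|C [y [[mC CB] pC /andP[my yM] Cy BCy]]] :=
  @threshold_subset f B m M e mB mM fB.
  by rewrite pB e0/= mulrS lerDl mulrn_wge0.
have [|||||k [x [mk pk [x0 xm] kx]]] := IH (B `\` C) y.
- exact: measurableD.
- by [].
- move=> w [Bw nC]; have /andP[-> _] := fB _ Bw; exact: BCy.
- by [].
- by rewrite probD// pB pC [X in X - _]mulrS addrAC subrr add0r.
pose k' w := if w \in C then 0%N else (k w).+1.
have k'0 : B `&` k' @^-1` [set 0%N] = C.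
  apply/seteqP; split => [w [Bw /=]|w Cw].
    by rewrite /k'; case: ifPn => // /set_mem.
  by split; [exact: CB|rewrite /= /k' mem_set].
have k'S i : B `&` k' @^-1` [set i.+1] = (B `\` C) `&` k @^-1` [set i].
  apply/seteqP; split => [w [Bw /=]|w [[Bw nC] /= kw]].
    by rewrite /k'; case: ifPn => // /negP wC [ki]; split => //; split =>
      // /mem_set.
  by split => //=; rewrite /k' memNset// kw.
exists k', (fun i => if i is j.+1 then x j else M); split.
- by case=> [|i]; rewrite ?k'0 ?k'S.
- by case=> [|i] iN; rewrite ?k'0 ?k'S ?pC// pk.
- split => // -[|i] iN; rewrite ?mM ?lexx//; have /andP[-> xy] := xm _ iN.
  by rewrite (le_trans xy).
- move=> w Bw; rewrite /k'; case: ifPn => [/set_mem Cw|/negP nC].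
    by rewrite x0 (Cy _ Cw); split=> //; have /andP[_ ->] := fB _ Bw.
  by have [|? ?] := kx w; first by split => // /mem_set.
Qed.

End Thresholds.

(** * Essentially bounded random variables *)

Section LinftyTheory.
Context (d : measure_display) (T : measurableType d) (R : realType).
Variable P : probability T R.
Implicit Types (X Y : Linfty P) (A B : set T) (c t M : R).
Local Notation prob := (prob P).

Lemma LinftyDE X Y w : (X + Y) w = X w + Y w.
Proof. by []. Qed.

Lemma Linfty_cstE c w : Linfty_cst P c w = c.
Proof. by []. Qed.

Lemma Lfun_infty_bounded (f : T -> R) M : measurable_fun setT f ->
  {ae P, forall w, `|f w| <= M} -> f \in Lfun P +oo%E.
Proof.
move=> mf fM; rewrite inE; apply/andP; split; rewrite inE//=.
rewrite /finite_norm unlock /= probability_setT lte01.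
apply: (@le_lt_trans _ _ M%:E); last exact: ltry.
by apply/ess_supP; apply: filterS fM => w /=; rewrite lee_fin.
Qed.

Lemma Linfty_ae_bounded X : exists2 M, 0 <= M & {ae P, forall w, `|X w| <= M}.
Proof.
have := @Lfunction_finite _ _ _ _ _ (leey 1%E) X;
  rewrite /finite_norm unlock /= probability_setT lte01.
set N := ess_sup _ _ => Noo.
exists `|fine N| => //.
have /ess_supP := lexx N; apply: filterS => w /= h.
rewrite -lee_fin; apply: le_trans h _; move: Noo.
by case: N => [r _|//|_]; [rewrite lee_fin ler_norm|rewrite leNye].
Qed.

Lemma Linfty_measurable X : measurable_fun setT X.
Proof. exact: measurable_funPT. Qed.

Lemma Linfty_integrable X A : measurable A -> P.-integrable A (EFin \o X).
Proof.
move=> mA; apply: (integrableS measurableT) => //.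
apply/Lfun1_integrable; apply: (@Lfun_subset _ _ _ P 1%E +oo%E);
  rewrite ?leey//.
  exact: fin_num_measure.
exact: LfunP.
Qed.
#[local] Hint Resolve Linfty_measurable Linfty_integrable : core.

(** Truncation at an essential bound. The threshold lemmas need bounds at every point of the set,
    not only almost everywhere. *)
Lemma Linfty_bounded_version X : exists M (Y : Linfty P),
  (forall w, - M <= Y w <= M) /\ {ae P, forall w, Y w = X w}.
Proof.
have [M M0 XM] := Linfty_ae_bounded X.
pose f w := Num.min (Num.max (X w) (- M)) M.
have fM w : - M <= f w <= M.
  by rewrite /f ge_min le_min le_max !lexx !orbT/= andbT; lra.
have fL : f \in Lfun P +oo%E.
  apply: (@Lfun_infty_bounded _ M); last by apply: aeW => w; rewrite ler_norml.
  by apply: measurable_minr => //; exact: measurable_maxr.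
exists M, (Lfun_Sub _ fL); split => //.
apply: filterS XM => w; rewrite ler_norml /= /f => /andP[h1 h2].
by rewrite max_l// min_l.
Qed.

Definition partial_mean A X : R := \int[P]_(w in A) X w.

Lemma partial_meanD A X Y : measurable A ->
  partial_mean A (X + Y) = partial_mean A X + partial_mean A Y.
Proof. by move=> mA; rewrite /partial_mean -RintegralD//;
  exact: Linfty_integrable. Qed.

Lemma partial_mean_cst A c : measurable A ->
  partial_mean A (Linfty_cst P c) = c * prob A.
Proof. by move=> mA; rewrite /partial_mean Rintegral_cst. Qed.

Lemma ae_eq_partial_mean A X Y : measurable A ->
  {ae P, forall w, A w -> X w = Y w} -> partial_mean A X = partial_mean A Y.
Proof.
move=> mA XY; congr fine; apply: ae_eq_integral => //.
- exact/measurable_EFinP/measurable_funTS.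
- exact/measurable_EFinP/measurable_funTS.
- by apply: filterS XY => w /= h Aw; rewrite h.
Qed.

(** The minimum of [X] and [Y] agrees with [X] almost everywhere on [A] and lies below [Y]
    everywhere. *)
Lemma ae_le_partial_mean A X Y : measurable A ->
  {ae P, forall w, A w -> X w <= Y w} -> partial_mean A X <= partial_mean A Y.
Proof.
move=> mA XY.
have [M M0 XM] := Linfty_ae_bounded X; have [N N0 YN] := Linfty_ae_bounded Y.
have minP : (fun w => Num.min (X w) (Y w)) \in Lfun P +oo%E.
  apply: (@Lfun_infty_bounded _ (Num.max M N)); first exact: measurable_minr.
  apply: filterS2 XM YN => w /= XwM YwN.
  by rewrite le_max minEle; case: ifP => _; rewrite ?XwM ?YwN ?orbT.
rewrite (@ae_eq_partial_mean A X (Lfun_Sub _ minP))//.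
  apply: (le_Rintegral mA (Linfty_integrable (Lfun_Sub _ minP) mA)).
    exact: Linfty_integrable.
  by move=> w _; rewrite /= ge_min lexx orbT.
by apply: filterS XY => w /= h Aw; rewrite min_l// h.
Qed.

Lemma partial_meanC A X : measurable A ->
  partial_mean setT X = partial_mean A X + partial_mean (~` A) X.
Proof.
move=> mA; have mAC := measurableC mA.
rewrite /partial_mean -(setUv A) Rintegral_setU//.
  by rewrite setUv; exact: Linfty_integrable.
by rewrite disj_set2E setICr.
Qed.

Lemma meanE X : mean X = partial_mean setT X.
Proof. by rewrite /mean unlock. Qed.

Fact excess_subproof X t : (fun w => Num.max (X w - t) 0) \in Lfun P +oo%E.
Proof.
have [M M0 XM] := Linfty_ae_bounded X.
apply: (@Lfun_infty_bounded _ (M + `|t|)).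
  apply: measurable_maxr => //; exact: measurable_funB.
apply: filterS XM => w /= XwM; rewrite maxEle; case: ifP => _.
  by rewrite normr0 addr_ge0.
by apply: le_trans (ler_normB _ _) _; rewrite lerD2r.
Qed.

Definition excess X t : Linfty P := Lfun_Sub _ (excess_subproof X t).

Lemma excessE X t w : excess X t w = Num.max (X w - t) 0.
Proof. by []. Qed.

End LinftyTheory.

(** * Expected shortfall *)

Section ExpectedShortfall.
Context (d : measure_display) (T : measurableType d) (R : realType).
Variable P : probability T R.
Implicit Types (X Y : Linfty P) (A B : set T) (p s x : R).
Local Notation prob := (prob P).

Let F X x : R := prob [set w | X w <= x].

Let F_nondecreasing X x y : x <= y -> F X x <= F X y.
Proof.
by move=> xy; apply: prob_le; [exact: measurable_mfun_le..|move=>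
  w /= /le_trans; exact].
Qed.

(* The quantile function and the distribution function form a Galois
   connection; it holds up to the end point [s = 1] because [X] is essentially
   bounded. *)
Lemma VaR_le X s x : 0 < s <= 1 -> (VaR s X <= x) = (s <= prob [set w |
  X w <= x]).
Proof.
move=> /andP[s0 s1]; rewrite -/(F X x).
have [M M0 XM] := Linfty_ae_bounded X.
pose S := [set x : R | (s%:E <= P [set w | (X w <= x)%R])%E].
have SE y : S y <-> s <= F X y.
  by rewrite /S/= probE ?lee_fin//; exact: measurable_mfun_le.
have SM : S M.
  apply/SE; apply: (le_trans s1); rewrite -(probT P); apply: ae_prob_le => //.
    exact: measurable_mfun_le.
  by apply: filterS XM => w /= XwM _; apply: le_trans XwM; exact: ler_norm.
have Slb : lbound S (- M - 1).
  move=> y /SE sy; rewrite leNgt; apply/negP => yM.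
  suff : F X y <= 0 by apply/negP; rewrite -ltNge (lt_le_trans s0).
  rewrite -(prob0 P); apply: ae_prob_le => //; first exact: measurable_mfun_le.
  by apply: filterS XM => w /=; rewrite ler_norml => /andP[? _] ?; lra.
have hS : has_inf S by split; [exists M|exists (- M - 1)].
have vE : VaR s X = inf S by [].
apply/idP/idP => [vx|sx]; last by rewrite vE; apply: ge_inf;
  [exists (- M - 1)|exact/SE].
apply: le_trans (F_nondecreasing X vx).
have eF : [set w | X w <= VaR s X] =
    \bigcap_n [set w | X w <= VaR s X + n.+1%:R^-1].
  apply/seteqP; split => [w /= Xw n _ /=|w Xw /=].
    by apply: le_trans Xw _; rewrite lerDl.
  rewrite leNgt; apply/negP => /ltr_add_invr[k]; apply/negP; rewrite -leNgt.
  exact: Xw k I.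
have ni : nonincreasing_seq (fun n => [set w | X w <= VaR s X + n.+1%:R^-1]).
  move=> i j ij; apply/subsetPset => w /= Xw; apply: le_trans Xw _.
  by rewrite lerD2l lef_pV2 ?posrE// ler_nat.
rewrite /F eF; apply: (cvgr_to_ge (prob_nonincreasing_cvg (P := P) _ ni)).
  by move=> n; exact: measurable_mfun_le.
apply: nearW => n; have [|y /SE sy yv] := inf_adherent _ hS (eps := n.+1%:R^-1).
  by rewrite invr_gt0.
by apply: le_trans sy _; apply: F_nondecreasing; exact: ltW.
Qed.

Lemma VaR_eq_law X Y s : eq_law X Y -> VaR s X = VaR s Y.
Proof.
move=> XY; rewrite /VaR; congr inf; apply/seteqP.
have E x : P [set w | X w <= x] = P [set w | Y w <= x].
  have := XY `]-oo, x] (measurable_itv _).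
  rewrite /distribution /pushforward /=.
  rewrite (_ : X @^-1` _ = [set w | X w <= x]); last first.
    by apply/seteqP; split => w; rewrite /= in_itv.
  by rewrite (_ : Y @^-1` _ = [set w | Y w <= x])//; apply/seteqP; split => w;
    rewrite /= in_itv.
by split => x /=; rewrite E.
Qed.

Lemma ES_eq_law p X Y : eq_law X Y -> ES p X = ES p Y.
Proof.
by move=> XY; congr (_ * fine _); apply: eq_integral => s _;
  rewrite (VaR_eq_law s XY).
Qed.

Section Formula.
Variables (X : Linfty P) (p : R).
Hypothesis hp : 0 < p < 1.
Let q := VaR p X.

(** Under the uniform law on [0, 1] this has the same law as [excess X q] under [P]. The default
    value 0 makes it nonnegative and measurable on the whole line. *)
Let tail s : R := if p < s <= 1 then VaR s X - q else 0.

Let p0 : 0 < p. Proof. by case/andP: hp. Qed.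
Let p1 : p < 1. Proof. by case/andP: hp. Qed.

Let tailE s : p <= s <= 1 -> VaR s X = q + tail s.
Proof.
move=> /andP[]; rewrite le_eqVlt /tail => /predU1P[<- _|-> ->].
  by rewrite ltxx/= addr0.
by rewrite addrC subrK.
Qed.

(** This is the Galois connection [VaR_le] for [s] above [p]; for smaller [s] both sides fail, since
    [p <= F X (q + x)]. *)
Let tail_gt x s : 0 <= x -> (x < tail s) = (F X (q + x) < s <= 1).
Proof.
move=> x0.
have pF : p <= F X (q + x).
  by rewrite -VaR_le; [rewrite lerDl|rewrite p0 ltW].
rewrite /tail; case: ifPn => [/andP[ps s1]|].
  rewrite s1 andbT ltrBrDr addrC !ltNge VaR_le//.
  by rewrite s1 andbT (lt_trans p0).
by rewrite [RHS]andbC negb_and -leNgt [in LHS]ltNge x0/= =>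
  /orP[sp|/negbTE->//];
  rewrite ltNge (le_trans sp pF) andbF.
Qed.

Let tail_ge0 s : 0 <= tail s.
Proof.
rewrite /tail; case: ifPn => // /andP[ps s1]; rewrite subr_ge0 VaR_le.
  apply: le_trans (ltW ps) _; rewrite -VaR_le// s1 andbT; exact: lt_trans ps.
by rewrite p0 ltW.
Qed.

Let measurable_tail : measurable_fun setT (tail : measurableTypeR R -> R).
Proof.
apply: (measurability _ (RGenOInfty.measurableE R)) => _ [_ [x ->] <-];
  rewrite setTI.
have [x0|x0] := leP 0 x.
  rewrite (_ : _ @^-1` _ = `]F X (q + x), 1]%classic)//.
  by apply/seteqP; split => s; rewrite /= !in_itv/= andbT tail_gt.
rewrite (_ : _ @^-1` _ = setT)//; apply/seteqP; split => // s _.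
by rewrite /= in_itv/= andbT (lt_le_trans x0).
Qed.

Let tail_mfun : {mfun measurableTypeR R >-> R} :=
  HB.pack (tail : measurableTypeR R -> R) (isMeasurableFun.Build _ _
    (measurableTypeR R) R tail measurable_tail).

(** Layer-cake formula on both sides: at every [x >= 0] the two survival functions equal
    [1 - F X (q + x)], on the left as the length of an interval. *)
Let integral_tail : (\int[lebesgue_measure]_(s in `[0%R, 1%R]) (tail s)%:E =
  \int[P]_w (excess X q w)%:E)%E.
Proof.
transitivity ('E_(uniform_prob (@ltr01 R))[tail_mfun])%E.
  rewrite unlock integral_uniform//=; first by rewrite subr0 invr1 mul1e.
  exact/measurable_EFinP.
transitivity ('E_P[excess X q])%E; last by rewrite unlock.
rewrite !ge0_expectation_ccdf//; last first.
  by move=> w; rewrite /= le_max lexx orbT.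
apply: eq_integral => x; rewrite inE/= in_itv/= andbT => x0.
rewrite /ccdf /distribution /pushforward.
rewrite (_ : tail_mfun @^-1` _ = `]F X (q + x), 1]%classic); last first.
  by apply/seteqP; split => s; rewrite /= !in_itv/= andbT tail_gt.
rewrite (_ : excess X q @^-1` _ = ~` [set w | X w <= q + x]); last first.
  apply/seteqP; split => w; rewrite /= in_itv/= andbT lt_max.
    by rewrite (ltNge x 0) x0 orbF ltrBrDr addrC ltNge => /negP.
  by move=> /negP; rewrite -ltNge ltrBrDr addrC => ->.
rewrite (_ : P _ = (1 - F X (q + x))%:E); last first.
  have mF := measurable_mfun_le X (q + x).
  by rewrite probE ?probC//; exact: measurableC.
rewrite -expectation_indic// unlock integral_uniform//=; last first.
  exact/measurable_EFinP.
rewrite subr0 invr1 mul1e integral_indic//= setIidl.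
  rewrite lebesgue_measure_itv/= lte_fin; case: ltP => // h.
  apply/eqP; rewrite eq_le !lee_fin; apply/andP; split;
    last by rewrite subr_le0.
  by rewrite subr_ge0 prob_le1//; exact: measurable_mfun_le.
apply: subset_itvr; rewrite bnd_simp; exact: prob_ge0.
Qed.

(* Rockafellar and Uryasev's formula. *)
Lemma ES_excess : (1 - p) * ES p X = (1 - p) * VaR p X + partial_mean setT (excess
  X (VaR p X)).
Proof.
have mD : measurable (`[p, 1]%classic : set (measurableTypeR R)) by exact:
  measurable_itv.
rewrite /ES mulrA divff ?mul1r; last by rewrite subr_eq0 gt_eqF.
rewrite -/q.
have itail : (\int[lebesgue_measure]_(s in `[p, 1%R]) (tail s)%:E =
    \int[P]_w (excess X q w)%:E)%E.
  (* Extending the domain to [0, 1] costs nothing, since [tail] vanishes up to [p]. *)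
  rewrite -integral_tail integral_mkcond [RHS]integral_mkcond.
  apply: eq_integral => s _; rewrite !patchE.
  case: ifPn; rewrite ?inE ?notin_setE/= !in_itv/= => hs.
    rewrite mem_set//= in_itv/=; case/andP: hs => ps ->; rewrite andbT.
    by rewrite (le_trans (ltW p0)).
  case: ifPn => //; rewrite inE/= in_itv/= => /andP[_ s1].
  by rewrite /tail; case: ifP => // /andP[ps _]; exfalso; apply: hs;
    rewrite (ltW ps).
have fin_excess : (\int[P]_w (excess X q w)%:E)%E \is a fin_num.
  exact: (integrable_fin_num measurableT (Linfty_integrable (excess X q)
    measurableT)).
have int_tail : lebesgue_measure.-integrable `[p, 1%R] (EFin \o tail).
  apply/integrableP; split; first exact/measurable_EFinP/measurable_funTS.
  under eq_integral do rewrite /= ger0_norm//.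
  rewrite itail -ge0_fin_numE//; apply: integral_ge0 => w _.
  by rewrite lee_fin le_max lexx orbT.
have int_q : lebesgue_measure.-integrable `[p, 1%R] (EFin \o cst q).
  apply/integrableP; split; first exact/measurable_EFinP/measurable_cst.
  rewrite (eq_integral (cst `|q|%:E))//.
  by rewrite integral_cst//= lebesgue_measure_itv/= lte_fin p1 -EFinB -EFinM
    ltry.
transitivity (\int[lebesgue_measure]_(s in `[p, 1]) (q + tail s)).
  by apply: eq_Rintegral => s; rewrite inE/= in_itv/= => /tailE.
rewrite RintegralD//.
have mu1 : fine (lebesgue_measure (`[p, 1%R]%classic : set R)) = 1 - p.
  by rewrite lebesgue_measure_itv/= lte_fin p1.
rewrite Rintegral_cst//= mu1 mulrC; congr (_ + _).
by rewrite /Rintegral itail.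
Qed.

End Formula.
End ExpectedShortfall.

(** * Tail events and the expected shortfall *)

Section TailEvents.
Context (d : measure_display) (T : measurableType d) (R : realType).
Variable P : probability T R.
Implicit Types (X Y : Linfty P) (A B : set T) (t x : R).
Local Notation prob := (prob P).
Variable p : R.
Hypothesis hp : 0 < p < 1.

Let p0 : 0 < p. Proof. by case/andP: hp. Qed.
Let p1 : p < 1. Proof. by case/andP: hp. Qed.

Lemma threshold_p_tail_event X A t : measurable A -> prob A = 1 - p ->
  {ae P, forall w, A w -> t <= X w} -> {ae P, forall w, ~ A w -> X w <= t} ->
  p_tail_event p X A.
Proof.
move=> mA pA tX Xt; split; last by rewrite probE// pA.
split => //; first by rewrite probE// pA !lte_fin subr_gt0 p1 ltrBlDr ltrDl p0.
apply: filterS tX => w h Aw; apply: filterS Xt => w' h' nAw'.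
by apply: le_trans (h' nAw') _; exact: h.
Qed.

Lemma p_tail_event_measurable X A : p_tail_event p X A -> measurable A.
Proof. by case=> -[]. Qed.

Lemma p_tail_event_prob X A : p_tail_event p X A -> prob A = 1 - p.
Proof. by case=> _; rewrite /prob => ->. Qed.

(** A typical point of [A] dominates [X] almost everywhere off [A], a set of mass [p], so [VaR_le]
    gives the first half. For the second, [S] has at least the mass [p] of the complement of [A]. If
    the part [N] of that complement outside [S] had positive mass, so would the part of [S] inside
    [A]; there [X] is at most [q] but should dominate the values above [q] taken on [N]. *)
Lemma p_tail_event_VaR X A : p_tail_event p X A ->
  {ae P, forall w, A w -> VaR p X <= X w} /\
  {ae P, forall w, ~ A w -> X w <= VaR p X}.
Proof.
move=> tA; have mA := p_tail_event_measurable tA; have pA :=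
  p_tail_event_prob tA.
have mAC := measurableC mA.
have pAC : prob (~` A) = p by rewrite probC// pA; lra.
case: tA => -[_ _ AX] _; set q := VaR p X.
have hp' : 0 < p <= 1 by rewrite p0 ltW.
split.
  apply: filterS AX => w h Aw; rewrite VaR_le// -[leLHS]pAC;
    apply: ae_prob_le => //.
    exact: measurable_mfun_le.
  by apply: filterS (h Aw) => w'; exact.
have mS := measurable_mfun_le X q; set S := [set w | _] in mS.
have pS : p <= prob S by rewrite -VaR_le.
pose N := ~` A `&` ~` S; have mN : measurable N by apply: measurableI => //;
  exact: measurableC.
suff N0 : prob N = 0.
  apply: filterS (prob0_ae mN N0) => w nN nA; rewrite leNgt; apply/negP => qX.
  by apply: nN; split => // /= ; rewrite /S/= leNgt qX.
apply/eqP; rewrite eq_le prob_ge0 andbT leNgt; apply/negP => N0.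
have mSA : measurable (S `&` A) by exact: measurableI.
have : 0 < prob (S `&` A).
  have := probIC P mS mA; have := probIC P mAC mS;
    rewrite (setIC S (~` A)) -/N; lra.
apply/negP; rewrite -leNgt -(prob0 P); apply: ae_prob_le => //.
apply: filterS AX => w h [Sw Aw].
move: N0; apply/negP; rewrite -leNgt -(prob0 P); apply: ae_prob_le => //.
apply: filterS (h Aw) => w' h' [nA /=]; apply; rewrite /S/=.
exact: le_trans (h' nA) Sw.
Qed.

(** [X] is at most [t] plus its excess over [t], and the excess is nonnegative off [A]. *)
Lemma partial_mean_le_excess X A t : measurable A ->
  partial_mean A X <= t * prob A + partial_mean setT (excess X t).
Proof.
move=> mA; rewrite (partial_meanC (excess X t) mA) -partial_mean_cst// addrA
  -partial_meanD//.
rewrite -[leLHS]addr0; apply: lerD.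
  by apply: ae_le_partial_mean => //; apply: aeW => w _;
    rewrite LinftyDE Linfty_cstE excessE maxEle; case: ifP => h; lra.
by apply: Rintegral_ge0 => w _; rewrite /= le_max lexx orbT.
Qed.

(** Both inequalities behind [partial_mean_le_excess] become equalities once [t] separates the
    values on [A] from those off [A]. *)
Lemma threshold_partial_mean_excess X A t : measurable A ->
  {ae P, forall w, A w -> t <= X w} -> {ae P, forall w, ~ A w -> X w <= t} ->
  partial_mean A X = t * prob A + partial_mean setT (excess X t).
Proof.
move=> mA tX Xt; rewrite (partial_meanC (excess X t) mA) -partial_mean_cst// addrA
  -partial_meanD//.
rewrite [X in _ + X](_ : _ = 0) ?addr0; last first.
  rewrite (@ae_eq_partial_mean _ _ _ _ _ _ (Linfty_cst P 0)) ?partial_mean_cst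
    ?mul0r//; try exact: measurableC.
  by apply: filterS Xt => w h nA; rewrite /= max_r// subr_le0 h.
apply: ae_eq_partial_mean => //; apply: filterS tX => w h Aw.
by rewrite LinftyDE Linfty_cstE excessE max_l ?subr_ge0 ?h// addrC subrK.
Qed.

Lemma ES_tail_event X A : p_tail_event p X A -> (1 - p) * ES p X = partial_mean A X.
Proof.
move=> tA; have [qX Xq] := p_tail_event_VaR tA.
rewrite (threshold_partial_mean_excess (p_tail_event_measurable tA) qX Xq).
by rewrite (p_tail_event_prob tA) ES_excess// mulrC.
Qed.

(** Together with [ES_tail_event], this says that [(1 - p) * ES p X] is the maximum of the integrals
    of [X] over events of mass [1 - p]; monotonicity and subadditivity follow. *)
Lemma partial_mean_le_ES X A : measurable A -> prob A = 1 - p ->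
  partial_mean A X <= (1 - p) * ES p X.
Proof.
by move=> mA pA; rewrite ES_excess// -pA mulrC; exact: partial_mean_le_excess.
Qed.

Hypothesis atomlessP : atomless P.

Lemma exists_p_tail_event X : exists A, p_tail_event p X A.
Proof.
have [M [Y [YM YX]]] := Linfty_bounded_version X.
have [|A [t [[mA _] pA _ h1 h2]]] :=
    threshold_subset atomlessP (f := Y) measurableT (bounds_le P YM)
      (fun w _ => YM w) (t := 1 - p).
  by rewrite probT subr_ge0 ltW//= lerBlDr lerDl ltW.
exists A; apply: (@threshold_p_tail_event _ _ t) => //.
  by apply: filterS YX => w <- /h1.
by apply: filterS YX => w <- /h2; exact.
Qed.

(** The variational half of Rockafellar and Uryasev's formula; [ES_excess] says that the bound is
    attained at [VaR p X]. *)
Lemma ES_le_excess X t : (1 - p) * ES p X <= (1 - p) * t + partial_mean setT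
  (excess X t).
Proof.
have [A tA] := exists_p_tail_event X.
rewrite (ES_tail_event tA) mulrC -(p_tail_event_prob tA).
exact/partial_mean_le_excess/(p_tail_event_measurable tA).
Qed.

Let onep_gt0 : 0 < 1 - p. Proof. by rewrite subr_gt0. Qed.

Lemma le_ES X Y : (forall w, X w <= Y w) -> ES p X <= ES p Y.
Proof.
move=> XY; have [A tA] := exists_p_tail_event X.
have mA := p_tail_event_measurable tA.
rewrite -(ler_pM2l onep_gt0) (ES_tail_event tA).
apply: le_trans (partial_mean_le_ES Y mA (p_tail_event_prob tA)).
by apply: ae_le_partial_mean => //; apply: aeW.
Qed.

Lemma ES_subadditive X Y : ES p (X + Y) <= ES p X + ES p Y.
Proof.
have [A tA] := exists_p_tail_event (X + Y).
have mA := p_tail_event_measurable tA; have pA := p_tail_event_prob tA.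
rewrite -(ler_pM2l onep_gt0) (ES_tail_event tA) partial_meanD// mulrDr.
by apply: lerD; exact: partial_mean_le_ES.
Qed.

Lemma ES_superadditive X Y A : p_tail_event p X A -> p_tail_event p Y A ->
  ES p X + ES p Y <= ES p (X + Y).
Proof.
move=> tX tY; have mA := p_tail_event_measurable tX.
rewrite -(ler_pM2l onep_gt0) mulrDr (ES_tail_event tX) (ES_tail_event tY).
rewrite -partial_meanD//; exact: partial_mean_le_ES mA (p_tail_event_prob tX).
Qed.

Lemma p_tail_event_cst A c : measurable A -> prob A = 1 - p ->
  p_tail_event p (Linfty_cst P c) A.
Proof. by move=> mA pA; apply: (@threshold_p_tail_event _ _ c) => //;
  apply: aeW. Qed.

Lemma ES_cst c : ES p (Linfty_cst P c) = c.
Proof.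
have [A tA] := exists_p_tail_event (Linfty_cst P c).
have mA := p_tail_event_measurable tA.
apply/(mulfI (lt0r_neq0 onep_gt0)).
by rewrite (ES_tail_event tA) partial_mean_cst// (p_tail_event_prob tA) mulrC.
Qed.

Lemma ESD_cst X c : ES p (X + Linfty_cst P c) = ES p X + c.
Proof.
have [A tA] := exists_p_tail_event X.
have mA := p_tail_event_measurable tA; have pA := p_tail_event_prob tA.
have := ES_subadditive X (Linfty_cst P c).
have := ES_superadditive tA (p_tail_event_cst c mA pA).
by rewrite ES_cst => ? ?; apply/eqP; rewrite eq_le; apply/andP.
Qed.

(** The average over a tail event is at least [VaR p X], the one over its complement at most
    [VaR p X]. This keeps [ES p X - mean X] in the half-line where a profile is constrained. *)
Lemma mean_le_ES X : mean X <= ES p X.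
Proof.
have [A tA] := exists_p_tail_event X.
have mA := p_tail_event_measurable tA; have pA := p_tail_event_prob tA.
have mAC := measurableC mA.
have [qX Xq] := p_tail_event_VaR tA.
have h1 : VaR p X * (1 - p) <= partial_mean A X.
  by rewrite -pA -partial_mean_cst//; exact: ae_le_partial_mean.
have h2 : partial_mean (~` A) X <= VaR p X * p.
  have pAC : prob (~` A) = p by rewrite probC// pA; lra.
  by rewrite -[X in _ * X]pAC -partial_mean_cst//; exact: ae_le_partial_mean.
rewrite meanE (partial_meanC X mA); have := ES_tail_event tA; set s :=
  partial_mean A X in h1 *.
move=> es; rewrite -(ler_pM2l onep_gt0) es.
have pp0 := p0; have pp1 := p1.
have : (1 - p) * partial_mean (~` A) X <= (1 - p) * (VaR p X * p) by rewrite
  ler_pM2l.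
have : p * (VaR p X * (1 - p)) <= p * s by rewrite ler_pM2l.
nra.
Qed.

Lemma meanD X Y : mean (X + Y) = mean X + mean Y.
Proof. by rewrite !meanE partial_meanD. Qed.

Lemma mean_cst c : mean (Linfty_cst P c) = c.
Proof. by rewrite meanE partial_mean_cst// probT mulr1. Qed.

Lemma le_mean X Y : (forall w, X w <= Y w) -> mean X <= mean Y.
Proof. by move=> XY; rewrite !meanE; apply: ae_le_partial_mean => //;
  apply: aeW. Qed.

Lemma mean_eq_law X Y : eq_law X Y -> mean X = mean Y.
Proof.
move=> XY; rewrite /mean !unlock; congr fine.
rewrite -[LHS](@integral_distribution _ _ _ _ _ P X EFin)//;
  last exact: Linfty_integrable.
rewrite -[RHS](@integral_distribution _ _ _ _ _ P Y EFin)//;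
  last exact: Linfty_integrable.
by apply: eq_measure_integral => A mA _; exact: XY.
Qed.

End TailEvents.

(** * Mean-ES functionals satisfy the axioms *)

Section MeanESRiskMeasure.
Context (d : measure_display) (T : measurableType d) (R : realType).
Variable P : probability T R.
Variable p : R.
Hypothesis hp : 0 < p < 1.
Hypothesis atomlessP : atomless P.
Implicit Types (X Y : Linfty P) (A : set T).

Lemma p_concentrated2P X Y : p_concentrated p [tuple X; Y] <->
  exists A, p_tail_event p X A /\ p_tail_event p Y A.
Proof.
split=> [[A tA]|[A [tX tY]]]; exists A.
  by split; [exact: (tA ord0)|exact: (tA (lift ord0 ord0))].
by case=> -[|[|//]] ?; rewrite /tnth/=.
Qed.

Lemma le_SSD_mean X Y :
  (forall u : R -> R, {homo u : x y / x <= y} -> convex_function [set: R^o] u ->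
    ('E_P[u \o X] <= 'E_P[u \o Y])%E) -> mean X <= mean Y.
Proof.
move=> XY; have := XY id (fun x y h => h).
have cid : convex_function [set: R^o] (@id R) by move=> t x y _ _.
move=> /(_ cid); rewrite !unlock => h; rewrite /mean !unlock.
by apply: fine_le => //; apply: integrable_fin_num => //;
  exact: Linfty_integrable.
Qed.

(** The test function is the excess over [q], the quantile of the dominating variable [Y]: at this
    level the excess formula bounds the shortfall of [X] and is exact for [Y]. *)
Lemma le_SSD_ES X Y :
  (forall u : R -> R, {homo u : x y / x <= y} -> convex_function [set: R^o] u ->
    ('E_P[u \o X] <= 'E_P[u \o Y])%E) -> ES p X <= ES p Y.
Proof.
move=> XY; case/andP: (hp) => p0 p1.
pose q := VaR p Y; pose u (x : R) := Num.max (x - q) 0.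
have u_homo : {homo u : x y / x <= y}.
  by move=> x y xy; rewrite /u ge_max !le_max lexx orbT andbT lerB.
have u_convex : convex_function [set: R^o] u.
  move=> t x y _ _; rewrite [X in u X <= _]convRE [X in _ <= X]convRE
    /unstable.onem /u ge_max.
  have t0 : 0 <= t%:num by [].
  have t1 : 0 <= 1 - t%:num by rewrite subr_ge0.
  have mx z : z - q <= Num.max (z - q) 0 by rewrite le_max lexx.
  have m0 z : 0 <= Num.max (z - q) 0 by rewrite le_max lexx orbT.
  apply/andP; split; last by rewrite addr_ge0// mulr_ge0.
  have := ler_wpM2l t0 (mx x); have := ler_wpM2l t1 (mx y); lra.
rewrite -(@ler_pM2l _ (1 - p)) ?subr_gt0//.
apply: le_trans (ES_le_excess hp atomlessP X q) _.
rewrite ES_excess// lerD2l; have := XY u u_homo u_convex; rewrite !unlock => h.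
apply: fine_le => //; apply: integrable_fin_num => //.
  exact: (Linfty_integrable (excess X q)).
exact: (Linfty_integrable (excess Y q)).
Qed.

Variables (rho : Linfty P -> R) (g : R -> R).
Hypotheses (g0 : g 0 = 0)
  (g_nd : forall x y : R, 0 <= x -> x <= y -> g x <= g y)
  (g_lip : forall x y : R, 0 <= x -> 0 <= y -> `|g x - g y| <= `|x - y|)
  (rhoE : forall X, rho X = g (ES p X - mean X) + mean X).

(** If [X] has the smaller deviation from its mean, monotonicity of [g] suffices. Otherwise the
    values of [g] differ by at most the difference of the deviations; adding the means leaves
    exactly the comparison of the shortfalls. *)
Lemma mean_ES_le X Y : mean X <= mean Y -> ES p X <= ES p Y -> rho X <= rho Y.
Proof.
move=> mXY eXY; rewrite !rhoE.
have X0 := mean_le_ES hp atomlessP X; have Y0 := mean_le_ES hp atomlessP Y.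
have [h|h] := leP (ES p X - mean X) (ES p Y - mean Y).
  by apply: lerD => //; apply: g_nd => //; rewrite subr_ge0.
have := @g_lip (ES p X - mean X) (ES p Y - mean Y).
rewrite !subr_ge0 => /(_ X0 Y0); rewrite ger0_norm ?subr_ge0; last first.
  by apply: g_nd; [rewrite subr_ge0|exact: ltW].
rewrite ger0_norm; [lra|by rewrite subr_ge0 ltW].
Qed.

Lemma mean_ES_axioms : [/\ risk_monotone rho, risk_translation_invariant rho,
  risk_concentration_averse p rho & rho 0 = 0].
Proof.
split.
- by move=> X Y XY; apply: mean_ES_le; [exact: le_mean|exact: le_ES].
- move=> X c; rewrite !rhoE ESD_cst// meanD mean_cst opprD addrACA subrr addr0.
  by rewrite addrA.
- move=> X Y X' Y' /p_concentrated2P[A [tX tY]] XX' YY'.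
  apply: mean_ES_le; first by rewrite !meanD (mean_eq_law XX') (mean_eq_law
    YY').
  apply: le_trans (ES_subadditive hp atomlessP _ _) _.
  rewrite (ES_eq_law _ XX') (ES_eq_law _ YY'); exact: ES_superadditive tX tY.
- have -> : (0 : Linfty P) = Linfty_cst P 0 by apply/LfuneqP.
  by rewrite rhoE ES_cst// mean_cst subrr g0 addr0.
Qed.

Lemma mean_ES_consistent : risk_consistent rho.
Proof.
have [M TI _ _] := mean_ES_axioms; split; first by split.
by move=> X Y XY; apply: mean_ES_le; [exact: le_SSD_mean|exact: le_SSD_ES].
Qed.

End MeanESRiskMeasure.

(** * Rearrangement of step functions *)

Section StepFunctions.
Context (d : measure_display) (T : measurableType d) (R : realType).
Variable P : probability T R.
Local Notation prob := (prob P).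

(** A finite measurable partition is encoded by the map sending each point to the index of its
    piece. *)
Definition measurable_label (J : finType) (k : T -> J) :=
  forall j, measurable (k @^-1` [set j]).

Lemma preimage_bigcup_fibers (J : finType) (k : T -> J) (S : set J) :
  k @^-1` S = \bigcup_(j in S) k @^-1` [set j].
Proof.
by apply/seteqP; split => [w Sw|w [j Sj /= ->]//]; exists (k w).
Qed.

Lemma measurable_label_preimage (J : finType) (k : T -> J) (S : set J) :
  measurable_label k -> measurable (k @^-1` S).
Proof.
by move=> mk; rewrite preimage_bigcup_fibers; exact: fin_bigcup_measurable.
Qed.

Lemma prob_label_eq (J : finType) (k l : T -> J) :
  measurable_label k -> measurable_label l ->
  (forall j, prob (k @^-1` [set j]) = prob (l @^-1` [set j])) ->
  forall S : set J, P (k @^-1` S) = P (l @^-1` S).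
Proof.
move=> mk ml kl S; have fS : finite_set S by exact: finite_finset.
have tI (h : T -> J) : trivIset S (fun j => h @^-1` [set j]).
  by move=> i j _ _ [w [/= <- <-]].
rewrite !preimage_bigcup_fibers !measure_fin_bigcup//.
have E j : P (k @^-1` [set j]) = P (l @^-1` [set j]) by rewrite !probE// kl.
by apply: eq_fsbigr => j _; exact: E.
Qed.

Section Step.
Variables (J : finType) (k : T -> J).
Hypothesis mk : measurable_label k.

Fact step_subproof (v : J -> R) : v \o k \in Lfun P +oo%E.
Proof.
apply: (@Lfun_infty_bounded _ _ _ _ _ (\sum_j `|v j|)).
  by move=> _ B mB; rewrite setTI comp_preimage;
    exact: measurable_label_preimage.
by apply: aeW => w; rewrite /= (bigD1 (k w))//= lerDl sumr_ge0.
Qed.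

Definition step (v : J -> R) : Linfty P := Lfun_Sub _ (step_subproof v).

Lemma stepE v w : step v w = v (k w).
Proof. by []. Qed.

End Step.

Lemma step_eq_law (J : finType) (k l : T -> J)
    (mk : measurable_label k) (ml : measurable_label l) (v : J -> R) :
  (forall j, prob (k @^-1` [set j]) = prob (l @^-1` [set j])) ->
  eq_law (step mk v) (step ml v).
Proof.
by move=> kl B mB; exact: (prob_label_eq mk ml kl (v @^-1` B)).
Qed.

Lemma eq_law_refl (X : Linfty P) : eq_law X X.
Proof. by []. Qed.

Variable p : R.
Hypothesis hp : 0 < p < 1.

Section CyclicShift.
Variables (N : nat) (k : T -> bool * 'I_N.+1).
Hypothesis mk : measurable_label k.
Hypothesis uniform_k :
  forall b i j, prob (k @^-1` [set (b, i)]) = prob (k @^-1` [set (b, j)]).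
(** The Boolean of a label tells on which side of the tail event a piece lies, the ordinal its place
    within that block. *)
Let A := k @^-1` [set j | j.1 = true].
Hypothesis pA : prob A = 1 - p.

Lemma step_p_tail_event (v : bool * 'I_N.+1 -> R) t :
  (forall i, t <= v (true, i)) -> (forall i, v (false, i) <= t) ->
  p_tail_event p (step mk v) A.
Proof.
move=> vt vf; apply: (@threshold_p_tail_event _ _ _ P p hp _ _ t) => //.
- exact: measurable_label_preimage.
- by apply: aeW => w; rewrite stepE /A/=; case: (k w) => -[].
- by apply: aeW => w; rewrite stepE /A/=; case: (k w) => -[].
Qed.

(** Addition in ['I_N.+1] is modulo [N.+1], so each block is rotated. *)
Definition shift_label (s : nat) (j : bool * 'I_N.+1) : bool * 'I_N.+1 :=
  (j.1, j.2 + inZp s).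

(** Rotating the label permutes its fibers inside a block, where they are equiprobable. *)
Lemma step_shift_eq_law (v : bool * 'I_N.+1 -> R) s :
  eq_law (step mk v) (step mk (v \o shift_label s)).
Proof.
have fib b i : (shift_label s \o k) @^-1` [set (b, i)] = k @^-1` [set (b,
  i - inZp s)].
  apply/seteqP; split => w /=; case: (k w) => c j; rewrite /shift_label/=.
    by case=> -> <-; rewrite addrK.
  by case=> -> ->; rewrite subrK.
have ms : measurable_label (shift_label s \o k) by move=> [b i]; rewrite fib.
have -> : step mk (v \o shift_label s) = step ms v by apply/LfuneqP => w.
by apply: step_eq_law => -[b i]; rewrite fib.
Qed.

(* Shared by risk measures averse to p-concentration, the expected shortfall
   and the mean: comparing the three on step functions avoids computing
   integrals. *)
Definition concentration_invariant (phi : Linfty P -> R) :=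
  forall X Y X' Y' : Linfty P, p_concentrated p [tuple X; Y] ->
    p_concentrated p [tuple X'; Y'] -> eq_law X X' -> eq_law Y Y' ->
    phi (X + Y) = phi (X' + Y').

Definition block_mean (v : bool * 'I_N.+1 -> R) b := (\sum_i v (b,
  i)) / N.+1%:R.

(* Cut the excess over [t] into [N.+1] equal slices and shift the [s]-th slice
   cyclically by [s]: each shift keeps the marginal laws and the common tail
   event, and after all the shifts the sum is constant on each block. *)
Lemma concentration_invariant_block_mean phi v t : concentration_invariant phi
  ->
  (forall i, t <= v (true, i)) -> (forall i, v (false, i) <= t) ->
  phi (step mk v) = phi (step mk (fun j => block_mean v j.1)).
Proof.
move=> phiP vt vf; pose n : R := N.+1%:R.
have n0 : 0 < n by rewrite ltr0n.
pose u j := (v j - t) / n.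
have ut i : 0 <= u (true, i) by rewrite divr_ge0 ?subr_ge0// ltW.
have uf i : u (false, i) <= 0 by rewrite pmulr_lle0 ?invr_gt0// subr_le0.
(* The state with [m] slices already rotated and [l] still in place. It is at least [t] on the tail
   event and at most [t] off it, hence concentrated with any further slice, rotated or not. *)
pose r m l j := t + \sum_(s < m) u (shift_label s j) + u j *+ l.
have rt m l i : t <= r m l (true, i).
  rewrite /r -addrA lerDl addr_ge0 ?mulrn_wge0//.
  by apply: sumr_ge0 => s _; exact: ut.
have rf m l i : r m l (false, i) <= t.
  rewrite /r -addrA gerDl -[leRHS]addr0 lerD ?mulrn_wle0//.
  by apply: sumr_le0 => s _; exact: uf.
have rS m l : phi (step mk (r m l.+1)) = phi (step mk (r m.+1 l)).
  have -> : step mk (r m l.+1) = step mk (r m l) + step mk u.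
    by apply/LfuneqP => w; rewrite LinftyDE !stepE /r mulrSr addrA.
  have -> : step mk (r m.+1 l) = step mk (r m l) + step mk (u \o shift_label m).
    by apply/LfuneqP => w; rewrite LinftyDE !stepE /r big_ord_recr/=; ring.
  apply: phiP.
  - apply/p_concentrated2P; exists A; split.
      exact: (step_p_tail_event (t := t)).
    exact: (step_p_tail_event (t := 0)).
  - apply/p_concentrated2P; exists A; split.
      exact: (step_p_tail_event (t := t)).
    by apply: (step_p_tail_event (t := 0)) => i; rewrite /= /shift_label/=.
  - exact: eq_law_refl.
  - exact: step_shift_eq_law.
have rE m l : phi (step mk (r 0%N (m + l)%N)) = phi (step mk (r m l)).
  elim: m l => [|m IH] l; first by rewrite add0n.
  by rewrite addSnnS IH rS.
transitivity (phi (step mk (r 0%N N.+1))).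
  congr phi; apply/LfuneqP => w; rewrite !stepE /r big_ord0 addr0 /u -mulr_natr.
  by rewrite divfK ?lt0r_neq0// addrC subrK.
rewrite -[X in r 0%N X]addn0 rE; congr phi; apply/LfuneqP => w; rewrite !stepE.
case: (k w) => b i; rewrite /r mulr0n addr0 /block_mean/= /u -mulr_suml.
rewrite -/n; apply: (canRL (mulfK _)); first exact: lt0r_neq0.
rewrite mulrDl divfK ?lt0r_neq0// sumrB sumr_const card_ord mulr_natr addrC
  subrK.
(* As [s] runs through ['I_N.+1], so does [i + s]: the rotated slices add up to the block total. *)
rewrite [RHS](reindex_inj (addrI i)).
by apply: eq_bigr => s _; rewrite /shift_label/= valZpK.
Qed.

End CyclicShift.

End StepFunctions.

(** * Risk measures averse to p-concentration *)

Section TwoValued.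
Context (d : measure_display) (T : measurableType d) (R : realType).
Variable P : probability T R.
Implicit Types (X Y : Linfty P) (A B : set T) (a b : R).
Local Notation prob := (prob P).

Lemma preimage_in_true A : (fun w => w \in A) @^-1` [set true] = A.
Proof. by apply/seteqP; split => w /=; [move/set_mem|move/mem_set]. Qed.

Lemma preimage_in_false A : (fun w => w \in A) @^-1` [set false] = ~` A.
Proof.
apply/seteqP; split => w /=; first by move/negbT/negP => nA /mem_set.
by move=> nA; apply: memNset.
Qed.

Fact measurable_label_in A : measurable A -> measurable_label (fun w =>
  w \in A).
Proof.
by move=> mA -[]; rewrite ?preimage_in_true ?preimage_in_false//;
  exact: measurableC.
Qed.

Definition two_valued A (mA : measurable A) a b : Linfty P :=
  step P (measurable_label_in mA) (fun c => if c then a else b).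

Lemma two_valuedE A (mA : measurable A) a b w :
  two_valued mA a b w = if w \in A then a else b.
Proof. by []. Qed.

Lemma two_valued_eq_law A B (mA : measurable A) (mB : measurable B) a b :
  prob A = prob B -> eq_law (two_valued mA a b) (two_valued mB a b).
Proof.
move=> AB; apply: step_eq_law => -[]; rewrite ?preimage_in_true
  ?preimage_in_false//.
by rewrite !probC// AB.
Qed.

Lemma partial_mean_two_valuedT A (mA : measurable A) a b :
  partial_mean A (two_valued mA a b) = a * prob A.
Proof.
rewrite -partial_mean_cst//; apply: ae_eq_partial_mean => //.
by apply: aeW => w Aw; rewrite two_valuedE mem_set.
Qed.

Lemma partial_mean_two_valuedC A (mA : measurable A) a b :
  partial_mean (~` A) (two_valued mA a b) = b * (1 - prob A).
Proof.
have mAC := measurableC mA.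
rewrite -probC// -partial_mean_cst//; apply: ae_eq_partial_mean => //.
by apply: aeW => w nA; rewrite two_valuedE memNset.
Qed.

Lemma mean_two_valued A (mA : measurable A) a b :
  mean (two_valued mA a b) = a * prob A + b * (1 - prob A).
Proof.
by rewrite meanE (partial_meanC _ mA) partial_mean_two_valuedT partial_mean_two_valuedC.
Qed.

Variable p : R.
Hypothesis hp : 0 < p < 1.

Lemma two_valued_p_tail_event A (mA : measurable A) a b :
  prob A = 1 - p -> b <= a -> p_tail_event p (two_valued mA a b) A.
Proof.
move=> pA ba; apply: (@threshold_p_tail_event _ _ _ P p hp _ _ a) => //;
  apply: aeW => w.
  by move=> Aw; rewrite two_valuedE mem_set.
by move=> nA; rewrite two_valuedE memNset.
Qed.

Lemma ES_two_valued A (mA : measurable A) a b :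
  prob A = 1 - p -> b <= a -> ES p (two_valued mA a b) = a.
Proof.
move=> pA ba; have p1 : 1 - p != 0 by case/andP: hp => _ p1;
  rewrite lt0r_neq0 ?subr_gt0.
apply: (mulfI p1).
by rewrite (ES_tail_event hp (two_valued_p_tail_event mA pA ba))
  partial_mean_two_valuedT pA mulrC.
Qed.

Lemma concentration_invariant_two_valued N (k : T -> bool * 'I_N.+1)
    (mk : measurable_label k) A (mA : measurable A) phi v t :
  (forall (c : bool) i j, prob (k @^-1` [set (c, i)]) = prob (k @^-1` [set (c,
    j)])) ->
  A = k @^-1` [set j | j.1 = true] -> prob A = 1 - p ->
    concentration_invariant p phi ->
  (forall i, t <= v (true, i)) -> (forall i, v (false, i) <= t) ->
  phi (step P mk v) = phi (two_valued mA (block_mean v true) (block_mean v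
    false)).
Proof.
move=> uk Ak pA phiP vt vf; rewrite Ak in pA.
rewrite (concentration_invariant_block_mean hp mk uk pA phiP vt vf).
congr phi; apply/LfuneqP => w; rewrite stepE two_valuedE.
case: ifPn => [/set_mem|/negP nA]; first by rewrite Ak/= => ->.
by case E : (k w).1 => //; case: nA; apply/mem_set; rewrite Ak.
Qed.

Hypothesis atomlessP : atomless P.

Lemma ES_concentration_invariant : concentration_invariant p (@ES _ T R P p).
Proof.
move=> X Y X' Y' /p_concentrated2P[A [tX tY]] /p_concentrated2P[A' [tX' tY']]
  XX' YY'.
have ESD (U V : Linfty P) B : p_tail_event p U B -> p_tail_event p V B ->
  ES p (U + V) = ES p U + ES p V.
  move=> tU tV; apply/eqP; rewrite eq_le ES_subadditive//=.
  exact: ES_superadditive tU tV.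
by rewrite (ESD _ _ A)// (ESD _ _ A')// (ES_eq_law _ XX') (ES_eq_law _ YY').
Qed.

Lemma mean_concentration_invariant : concentration_invariant p (@mean _ T R P).
Proof.
by move=> X Y X' Y' _ _ XX' YY'; rewrite !meanD (mean_eq_law XX') (mean_eq_law
  YY').
Qed.

End TwoValued.

(** * The profile function of a concentration-averse risk measure *)

Section Characterization.
Context (d : measure_display) (T : measurableType d) (R : realType).
Variable P : probability T R.
Implicit Types (X Y : Linfty P) (a b : R).
Local Notation prob := (prob P).
Variable p : R.
Hypotheses (hp : 0 < p < 1) (atomlessP : atomless P).
Variable rho : Linfty P -> R.
Hypotheses (rhoM : risk_monotone rho) (rhoTI : risk_translation_invariant rho)
  (rhoCA : risk_concentration_averse p rho).

(** Aversion is applied with the constant 0 as second summand, which shares every tail event of the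
    first. *)
Lemma concentration_averse_law_invariant X Y : eq_law X Y -> rho X = rho Y.
Proof.
suff H (U V : Linfty P) : eq_law U V -> rho U <= rho V.
  by move=> XY; apply/eqP; rewrite eq_le !H// => B mB; rewrite XY.
move=> UV; have [A tA] := exists_p_tail_event hp atomlessP V.
have c0 (W : Linfty P) : W + Linfty_cst P 0 = W by apply/LfuneqP => w;
  rewrite LinftyDE addr0.
rewrite -(c0 U) -(c0 V); apply: rhoCA => //; apply/p_concentrated2P; exists A.
split=> //; apply: (p_tail_event_cst hp).
  exact: p_tail_event_measurable tA.
exact: p_tail_event_prob tA.
Qed.

Lemma concentration_averse_invariant : concentration_invariant p rho.
Proof.
move=> X Y X' Y' cXY cXY' XX' YY'; apply/eqP; rewrite eq_le !rhoCA//.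
  by move=> B mB; rewrite XX'.
by move=> B mB; rewrite YY'.
Qed.

Variables (A0 : set T) (mA0 : measurable A0).
Hypothesis pA0 : prob A0 = 1 - p.
(** By law invariance, the fixed event [A0] can stand in for any event of mass [1 - p]. *)
Let h a b := rho (two_valued P mA0 a b).

Let h_le a b a' b' : a <= a' -> b <= b' -> h a b <= h a' b'.
Proof.
by move=> aa' bb'; apply: rhoM => w; rewrite !two_valuedE; case: ifP.
Qed.

Let hD a b c : h (a + c) (b + c) = h a b + c.
Proof.
rewrite /h -rhoTI; congr rho; apply/LfuneqP => w.
by rewrite LinftyDE !two_valuedE Linfty_cstE; case: ifP.
Qed.

(** The average of [X] over the complement of a p-tail event, written so as not to depend on the
    event. *)
Let lower_mean X := (mean X - (1 - p) * ES p X) / p.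

(** The two sums share all terms but the first of one and the last of the other. *)
Lemma block_mean_telescope N (x : nat -> R) M : `|x 0%N - x N.+1| <= M ->
  (\sum_(i < N.+1) x i) / N.+1%:R <= (\sum_(i < N.+1) x i.+1) / N.+1%:R + M /
    N.+1%:R.
Proof.
move=> xM; rewrite -mulrDl ler_pM2r ?invr_gt0//.
have : \sum_(i < N.+1) x i - \sum_(i < N.+1) x i.+1 <= M.
  rewrite big_ord_recl big_ord_recr/= opprD addrA addrK.
  exact: le_trans (ler_norm _) xM.
lra.
Qed.

(** Two step functions on one partition bracket [X]. Averaging turns them into two-valued variables
    whose values bracket [ES p X] and [lower_mean X] with a gap of at most [2 * M / N.+1%:R], and
    [N] is arbitrary. *)
Lemma bounded_rhoE X M : (forall w, - M <= X w <= M) ->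
  rho X = h (ES p X) (lower_mean X).
Proof.
move=> XM; case/andP: (hp) => p0 p1.
have [|A [t [[mA _] pA /andP[Mt tM] tX Xt]]] :=
    threshold_subset atomlessP (f := X) measurableT (bounds_le P XM)
      (fun w _ => XM w) (t := 1 - p).
  by rewrite probT subr_ge0 ltW//= lerBlDr lerDl ltW.
have mAC := measurableC mA; have pAC : prob (~` A) = p by rewrite probC// pA;
  lra.
have tailX : p_tail_event p X A.
  by apply: (@threshold_p_tail_event _ _ _ P p hp _ _ t) => //; apply: aeW =>
    // w /Xt; exact.
suff bound N : rho X <= h (ES p X) (lower_mean X) + (2 * M) / N.+1%:R /\
    h (ES p X) (lower_mean X) <= rho X + (2 * M) / N.+1%:R.
  have small e : 0 < e -> exists N, (2 * M) / N.+1%:R <= e.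
    move=> e0; exists (Num.bound (2 * M / e));
      rewrite ler_pdivrMr// [e * _]mulrC -ler_pdivrMr//.
    have : 2 * M / e < (Num.bound (2 * M / e))%:R.
      by apply: archi_boundP; rewrite divr_ge0 ?(ltW e0)//; lra.
    by move/ltW/le_trans; apply; rewrite ler_nat.
  apply/eqP; rewrite eq_le; apply/andP; split; apply/ler_addgt0Pr =>
    e /small[N NE].
    by apply: le_trans (bound N).1 _; rewrite lerD2l.
  by apply: le_trans (bound N).2 _; rewrite lerD2l.
have n0 : 0 < N.+1%:R :> R by rewrite ltr0n.
(* Each block is cut into [N.+1] equiprobable pieces, with thresholds between [t] and [M] on [A],
   and between [- M] and [t] off [A]. *)
have [|||k1 [x1 [mk1 pk1 [_ x1m] kx1]]] :=
    @threshold_partition _ _ _ P atomlessP X A t M N ((1 - p) / N.+1%:R) mA tM.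
- by move=> w Aw; rewrite tX//=; have /andP[] := XM w.
- by rewrite divr_ge0 ?subr_ge0// ltW.
- by rewrite pA -[RHS]mulr_natr divfK ?lt0r_neq0.
have [|||k2 [x2 [mk2 pk2 [_ x2m] kx2]]] :=
    @threshold_partition _ _ _ P atomlessP X (~` A) (- M) t N (p / N.+1%:R) mAC
      Mt.
- by move=> w nA; rewrite Xt// andbT; have /andP[] := XM w.
- by rewrite divr_ge0// ltW.
- by rewrite pAC -[RHS]mulr_natr divfK ?lt0r_neq0.
pose k w : bool * 'I_N.+1 := if w \in A then (true, inord (k1 w)) else (false,
  inord (k2 w)).
have kT i : k @^-1` [set (true, i)] = A `&` k1 @^-1` [set (i : nat)].
  apply/seteqP; split => w /=; rewrite /k.
    case: ifPn => [/set_mem Aw [<-]|//]; split => //.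
    by rewrite /= inordK// ltnS; have [] := kx1 w Aw.
  by move=> [Aw /= kwi]; rewrite mem_set// kwi inord_val.
have kF i : k @^-1` [set (false, i)] = ~` A `&` k2 @^-1` [set (i : nat)].
  apply/seteqP; split => w /=; rewrite /k.
    case: ifPn => [//|/negP nA [<-]]; have {}nA : ~ A w by move=> /mem_set.
    by split => //; rewrite /= inordK// ltnS; have [] := kx2 w nA.
  by move=> [nA /= kwi]; rewrite memNset// kwi inord_val.
have mk : measurable_label k by move=> [[] i]; rewrite ?kT ?kF.
have uk (b : bool) i j : prob (k @^-1` [set (b, i)]) = prob (k @^-1` [set (b,
  j)]).
  by case: b; rewrite ?kT ?kF ?pk1 ?pk2// -ltnS.
have Ak : A = k @^-1` [set j | j.1 = true].
  apply/seteqP; split => w /=; rewrite /k; first by move=> Aw; rewrite mem_set.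
  by case: ifPn => // /set_mem.
pose x (b : bool) := if b then x1 else x2.
(* The thresholds are listed downwards, so index [i] bounds a piece from above and [i.+1] from
   below. *)
pose up (j : bool * 'I_N.+1) := x j.1 j.2.
pose lo (j : bool * 'I_N.+1) := x j.1 j.2.+1.
have upT i : t <= up (true, i) by have /andP[] := x1m i (ltnW (ltn_ord i)).
have upF i : up (false, i) <= t by have /andP[] := x2m i (ltnW (ltn_ord i)).
have loT i : t <= lo (true, i) by have /andP[] := x1m i.+1 (ltn_ord i).
have loF i : lo (false, i) <= t by have /andP[] := x2m i.+1 (ltn_ord i).
have Xup w : X w <= step P mk up w.
  rewrite stepE /up /k; case: ifPn => [/set_mem Aw|/negP nA] /=.
    by have [kN /andP[_ ]] := kx1 w Aw; rewrite inordK.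
  have {}nA : ~ A w by move=> /mem_set.
  by have [kN /andP[_ ]] := kx2 w nA; rewrite inordK.
have loX w : step P mk lo w <= X w.
  rewrite stepE /lo /k; case: ifPn => [/set_mem Aw|/negP nA] /=.
    by have [kN /andP[+ _]] := kx1 w Aw; rewrite inordK.
  have {}nA : ~ A w by move=> /mem_set.
  by have [kN /andP[+ _]] := kx2 w nA; rewrite inordK.
have gap (b : bool) : block_mean up b <= block_mean lo b + 2 * M / N.+1%:R.
  apply: block_mean_telescope.
  case: b; rewrite ler_norml.
    by have /andP[] := x1m 0%N isT; have /andP[] := x1m N.+1 (leqnn _);
      rewrite /x; lra.
  by have /andP[] := x2m 0%N isT; have /andP[] := x2m N.+1 (leqnn _);
    rewrite /x; lra.
have stepP v : (forall i, t <= v (true, i)) -> (forall i, v (false, i) <= t) ->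
    [/\ rho (step P mk v) = h (block_mean v true) (block_mean v false),
        ES p (step P mk v) = block_mean v true,
        lower_mean (step P mk v) = block_mean v false &
        p_tail_event p (step P mk v) A].
  move=> vT vF.
  have bv : block_mean v false <= block_mean v true.
    by rewrite ler_pM2r ?invr_gt0//; apply: ler_sum => i _;
      exact: le_trans (vF i) _.
  have E phi (phiP : concentration_invariant p phi) :=
    concentration_invariant_two_valued hp mk mA uk Ak pA phiP vT vF.
  have ESv : ES p (step P mk v) = block_mean v true.
    rewrite (E (@ES _ T R P p)); last exact: ES_concentration_invariant.
    exact: ES_two_valued.
  split => //.
  - rewrite (E rho); last exact: concentration_averse_invariant.
    by apply: concentration_averse_law_invariant; apply: two_valued_eq_law;
      rewrite pA.
  - rewrite /lower_mean ESv (E (@mean _ T R P));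
    last exact: mean_concentration_invariant.
    by rewrite mean_two_valued pA; field; exact: lt0r_neq0.
  - rewrite Ak; apply: (step_p_tail_event hp mk _ vT vF); by rewrite -Ak.
have lower_meanE Y : p_tail_event p Y A -> lower_mean Y = partial_mean (~` A) Y / p.
  move=> tY; rewrite /lower_mean (ES_tail_event hp tY) meanE (partial_meanC Y mA).
  by rewrite addrAC subrr add0r.
have lower_mean_le Y Z : p_tail_event p Y A -> p_tail_event p Z A ->
    (forall w, Y w <= Z w) -> lower_mean Y <= lower_mean Z.
  move=> tY tZ YZ; rewrite !lower_meanE// ler_pM2r ?invr_gt0//.
  by apply: ae_le_partial_mean => //; apply: aeW.
have [rup ESup mup tup] := stepP up upT upF.
have [rlo ESlo mlo tlo] := stepP lo loT loF.
have a1 := le_ES hp atomlessP Xup; have a2 := le_ES hp atomlessP loX.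
have b1 := lower_mean_le _ _ tailX tup Xup; have b2 :=
  lower_mean_le _ _ tlo tailX loX.
rewrite ESup in a1; rewrite mup in b1; rewrite ESlo in a2; rewrite mlo in b2.
(* By [hD], raising both lower block means by the gap raises [h] by exactly the gap; [rho X] and
   [h (ES p X) (lower_mean X)] both lie between the values at [lo] and [up]. *)
split.
  apply: le_trans (rhoM Xup) _; rewrite rup -hD; apply: h_le.
    by apply: le_trans (gap true) _; rewrite lerD2r.
  by apply: le_trans (gap false) _; rewrite lerD2r.
apply: le_trans (_ : h (block_mean up true) (block_mean up false) <= _);
  first exact: h_le.
apply: le_trans (_ : _ <= rho (step P mk lo) + 2 * M / N.+1%:R) _.
  by rewrite rlo -hD; apply: h_le; exact: gap.
by rewrite lerD2r; exact: rhoM.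
Qed.

(** The second value makes the mean zero; for [x >= 0] the shortfall is then [x]. *)
Definition risk_profile x := rho (two_valued P mA0 x (- ((1 - p) / p * x))).
Local Notation g := risk_profile.

Lemma rho_mean_ES X : rho X = g (ES p X - mean X) + mean X.
Proof.
case/andP: (hp) => p0 p1.
have [M [Y [YM YX]]] := Linfty_bounded_version X.
(* Almost sure equality matters to [rho] only through law invariance. *)
have XY : eq_law X Y.
  move=> B mB; rewrite /distribution /pushforward.
  have mX : measurable (X @^-1` B) by exact: measurable_funPTI.
  have mY : measurable (Y @^-1` B) by exact: measurable_funPTI.
  rewrite !probE//; congr EFin; apply/eqP; rewrite eq_le; apply/andP; split;
    by apply: ae_prob_le => //; apply: filterS YX => w /= ->.
rewrite (concentration_averse_law_invariant XY) (ES_eq_law p XY) (mean_eq_law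
  XY).
rewrite (bounded_rhoE (M := M))// /g -[rho (two_valued _ _ _ _)]/(h _ _) -hD.
congr (h _ _); first by rewrite subrK.
by rewrite /lower_mean; field; exact: lt0r_neq0.
Qed.

(** Adding [y - x] to the variable defining [g x] gives the one defining [g y] on [A0], and a larger
    one off [A0]. *)
Lemma risk_profile_ge x y : 0 <= x -> x <= y -> g y <= g x + (y - x).
Proof.
move=> x0 xy; case/andP: (hp) => p0 p1.
rewrite /g -!/(h _ _) -hD; apply: h_le; first by rewrite addrC subrK.
have k0 : 0 <= (1 - p) / p by rewrite divr_ge0 ?subr_ge0 ?ltW.
have := ler_wpM2l k0 xy; lra.
Qed.

(* With [C] inside and [D] outside the tail event, the random variable
   [Z + l 1_C - l 1_D] is the sum of the concentrated pair [Z + l 1_C] and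
   [- l 1_D]; rearranging the latter into [- l 1_C] leaves [Z]. *)
Lemma risk_profile_nondecreasing x y : 0 <= x -> x <= y -> g x <= g y.
Proof.
move=> x0 xy; case/andP: (hp) => p0 p1.
have mA0C := measurableC mA0.
(* The mass [p * (1 - p)] fits both in [A0], of mass [1 - p], and in its complement, of mass [p]. *)
have [|C [mC CA pC]] := atomless_subset atomlessP (t := p * (1 - p)) mA0.
  rewrite pA0; nra.
have [|D [mD DA pD]] := atomless_subset atomlessP (t := p * (1 - p)) mA0C.
  rewrite probC// pA0; nra.
(* With this height, [C] adds [(1 - p) * (y - x)] to the integral over [A0], that is, [y - x] to the
   shortfall. *)
pose l := (y - x) / p.
have l0 : 0 <= l by rewrite divr_ge0 ?subr_ge0// ltW.
have k0 : 0 <= (1 - p) / p by rewrite divr_ge0 ?subr_ge0 ?ltW.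
have kx0 : - ((1 - p) / p * x) <= 0 by rewrite oppr_le0 mulr_ge0.
pose Z := two_valued P mA0 x (- ((1 - p) / p * x)).
pose X := Z + two_valued P mC l 0.
pose Y := two_valued P mC (- l) 0; pose Y' := two_valued P mD (- l) 0.
have tX : p_tail_event p X A0.
  apply: (@threshold_p_tail_event _ _ _ P p hp _ _ x) => //; apply: aeW => w.
    by move=> Aw; rewrite LinftyDE !two_valuedE mem_set// lerDl; case: ifP.
  move=> nA; rewrite LinftyDE !two_valuedE memNset// memNset; last by move/CA.
  by rewrite addr0 (le_trans kx0).
have tY' : p_tail_event p Y' A0.
  apply: (@threshold_p_tail_event _ _ _ P p hp _ _ 0) => //; apply: aeW => w.
    by move=> Aw; rewrite two_valuedE memNset// => /DA.
  by move=> nA; rewrite two_valuedE; case: ifP; rewrite ?oppr_le0.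
have -> : g x = rho (X + Y).
  congr rho; apply/LfuneqP => w; rewrite !LinftyDE -addrA !two_valuedE.
  by case: (w \in C); rewrite ?subrr !addr0.
apply: le_trans (_ : rho (X + Y') <= _).
  apply: rhoCA; [by apply/p_concentrated2P; exists A0|exact: eq_law_refl|].
  by apply: two_valued_eq_law; rewrite pC pD.
have mXY : mean (X + Y') = 0.
  rewrite !meanD !mean_two_valued pA0 pC pD; field; exact: lt0r_neq0.
have partial_meanCl : partial_mean A0 (two_valued P mC l 0) = l * (p * (1 - p)).
  have := mean_two_valued P mC l 0; rewrite mul0r addr0 pC => <-.
  rewrite meanE (partial_meanC _ mA0) -[LHS]addr0; congr (_ + _).
  rewrite (@ae_eq_partial_mean _ _ _ _ _ _ (Linfty_cst P 0)) ?partial_mean_cst ?mul0r//.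
  by apply: aeW => w nA; rewrite two_valuedE memNset// => /CA.
have partial_meanY' : partial_mean A0 Y' = 0.
  rewrite (@ae_eq_partial_mean _ _ _ _ _ _ (Linfty_cst P 0)) ?partial_mean_cst ?mul0r//.
  by apply: aeW => w Aw; rewrite two_valuedE memNset// => /DA; exact.
have ESXY : ES p (X + Y') = y.
  have p1' : 1 - p != 0 by rewrite lt0r_neq0// subr_gt0.
  have ES1 : ES p X + ES p Y' = y.
    apply: (mulfI p1'); rewrite mulrDr (ES_tail_event hp tX) (ES_tail_event hp
      tY').
    rewrite partial_meanY' addr0 partial_meanD// partial_meanCl partial_mean_two_valuedT pA0 /l.
    by field; exact: lt0r_neq0.
  rewrite -ES1; apply/eqP; rewrite eq_le ES_subadditive//=.
  exact: ES_superadditive tX tY'.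
by rewrite rho_mean_ES mXY ESXY subr0 addr0.
Qed.

Lemma risk_profile_lipschitz x y : 0 <= x -> 0 <= y -> `|g x - g y| <= `|x - y|.
Proof.
wlog xy : x y / x <= y.
  move=> H x0 y0; have [xy|/ltW yx] := leP x y; first exact: H.
  by rewrite distrC [leRHS]distrC; exact: H.
move=> x0 y0; have := risk_profile_ge x0 xy; have :=
  risk_profile_nondecreasing x0 xy.
by move=> h1 h2; rewrite ler0_norm ?subr_le0// ler0_norm ?subr_le0//; lra.
Qed.

End Characterization.

Theorem theorem3 (d : measure_display) (T : measurableType d) (R : realType)
    (P : probability T R) (hP : atomless P) (p : R) (hp : 0 < p < 1)
    (rho : Linfty P -> R) :
  ([/\ risk_monotone rho, risk_translation_invariant rho,
       risk_concentration_averse p rho & rho 0 = 0] <->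
   exists g : R -> R,
     [/\ g 0 = 0,
         forall x y : R, 0 <= x -> x <= y -> g x <= g y,
         forall x y : R, 0 <= x -> 0 <= y -> `|g x - g y| <= `|x - y| &
         forall X : Linfty P, rho X = g (ES p X - mean X) + mean X]) /\
  ([/\ risk_monotone rho, risk_translation_invariant rho,
       risk_concentration_averse p rho & rho 0 = 0] ->
   risk_consistent rho).
Proof.
(* Isolated because consistency is also obtained through the profile. *)
have char : [/\ risk_monotone rho, risk_translation_invariant rho,
    risk_concentration_averse p rho & rho 0 = 0] ->
  exists g : R -> R, [/\ g 0 = 0,
      forall x y : R, 0 <= x -> x <= y -> g x <= g y,
      forall x y : R, 0 <= x -> 0 <= y -> `|g x - g y| <= `|x - y| &
      forall X : Linfty P, rho X = g (ES p X - mean X) + mean X].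
  case=> M TI CA rho0; have /andP[p0 p1] := hp.
  have [|A [mA _ pA]] := atomless_subset hP (t := 1 - p) measurableT.
    by rewrite probT subr_ge0 ltW//= lerBlDr lerDl ltW.
  exists (risk_profile p rho mA); split.
  - rewrite -[RHS]rho0; congr rho; apply/LfuneqP => w.
    by rewrite two_valuedE mulr0 oppr0; case: ifP.
  - exact: risk_profile_nondecreasing.
  - exact: risk_profile_lipschitz.
  - exact: rho_mean_ES.
split; first split => // -[g [g0 g_nd g_lip rhoE]].
  exact: (mean_ES_axioms hp hP g0 g_nd g_lip rhoE).
case/char=> g [g0 g_nd g_lip rhoE].
exact: (mean_ES_consistent hp hP g0 g_nd g_lip rhoE).
Qed.
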